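(* Let the parametric penalty function $F_{\lambda}$ be bounded below on $A \times P$ for some $\lambda \ge 0$. Then $$\sup_{\lambda \ge 0} \inf_{(x, p) \in A \times P} F_{\lambda}(x, p) = \lim_{\eta \to +0} \beta(\eta),$$ where $\beta(\eta) = \inf\{ f(x) \mid x \in A,\ \inf_{p \in P} \varphi(x, p) \le \eta \}$ for $\eta \ge 0$.
   Context: Setting. $X$ and $P$ are metric spaces, $M, A \subset X$ are nonempty, $f \colon X \to \mathbb{R} \cup \{+\infty\}$. The problem $(\mathcal{P})$ is: minimize $f(x)$ subject to $x \in M$, $x \in A$. $\Omega = M \cap A$; it is assumed that $f$ attains a global minimum on $\Omega$, with finite value $f^*$. $p_0 \in P$ is fixed, and $\varphi \colon X \times P \to [0, +\infty]$ satisfies $\varphi(x, p) = 0$ iff $p = p_0$ and $x \in M$. The parametric penalty function is $F_{\lambda}(x, p) = f(x) + \lambda \varphi(x, p)$, $\lambda \ge 0$. The function $\beta$ is non-increasing on $[0,+\infty)$, so its limit as $\eta \to +0$ exists. *)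

(* Defs.v *)
From HB Require Import structures.
From mathcomp Require Import all_boot all_order all_algebra.
From mathcomp Require Import all_classical all_reals all_analysis.

Set Implicit Arguments.
Unset Strict Implicit.
Unset Printing Implicit Defensive.

Import Order.TTheory GRing.Theory Num.Theory.
Import numFieldNormedType.Exports.

Local Open Scope classical_set_scope.
Local Open Scope ring_scope.
Local Open Scope ereal_scope.

Section ParametricPenalty.
Context {R : realType} {X P : Type}.
Implicit Types (f : X -> \bar R) (phi : X * P -> \bar R) (A : set X).

Definition attains_finite_min (T : Type) (f : T -> \bar R) (Omega : set T) :=
  exists xs, [/\ Omega xs, f xs \is a fin_num &
    forall x, Omega x -> f xs <= f x].

(* For lambda = 0 and phi z = +oo the product is 0 (the convention 0 * oo = 0),
   so penalty f phi 0 (x, p) = f x. *)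
Definition penalty f phi (lambda : R) (z : X * P) : \bar R :=
  f z.1 + lambda%:E * phi z.

Definition bounded_below_on (T : Type) (g : T -> \bar R) (D : set T) :=
  exists m : R, forall z, D z -> m%:E <= g z.

Definition beta f phi A (eta : R) : \bar R :=
  ereal_inf [set f x | x in
    [set x | A x /\ ereal_inf [set phi (x, p) | p in [set: P]] <= eta%:E]].

End ParametricPenalty.

(* Main.v *)
(** For [inf F_lambda <= lim beta], any [x] feasible for [beta eta] has a
    parameter [p] with [phi (x, p) < 2 eta], so [F_lambda (x, p)] exceeds [f x]
    by at most [2 lambda eta].  Conversely, fix [eta > 0] and a real number
    [c <= beta eta]: where [inf_p phi (x, p) <= eta] we have
    [F_lambda (x, p) >= f x >= c], while elsewhere [phi (x, p) > eta], so raising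
    [lambda] by [k] above a value at which [F] is bounded below by [m] gives
    [F >= m + k eta], which exceeds [c] for [k] large. *)
Require Import Defs.
From HB Require Import structures.
From mathcomp Require Import all_boot all_order all_algebra.
From mathcomp Require Import all_classical all_reals all_analysis.
Import Order.TTheory GRing.Theory Num.Theory.
Import numFieldNormedType.Exports.
Local Open Scope classical_set_scope.
Local Open Scope ring_scope.
Local Open Scope ereal_scope.

Lemma beta_nonincreasing (R : realType) (X P : Type) (A : set X)
  (f : X -> \bar R) (phi : X * P -> \bar R) (s t : R) :
  (s <= t)%R -> beta f phi A t <= beta f phi A s.
Proof.
move=> st; apply: ereal_inf_le_tmp => _ [x [Ax xs] <-].
by exists x => //; split=> //; apply: le_trans xs _; rewrite lee_fin.
Qed.

(** The infimum of [phi (x, p)] over [p] need not be attained; the strict gap [eta < delta] yields a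
    [p] with [phi (x, p) < delta], whose penalty term costs at most [lambda * delta]. *)
Lemma inf_penalty_le_beta (R : realType) (X P : Type) (A : set X)
  (f : X -> \bar R) (phi : X * P -> \bar R) (lambda eta delta : R) :
  (0 <= lambda)%R -> (eta < delta)%R ->
  ereal_inf [set penalty f phi lambda z | z in A `*` [set: P]] <=
    beta f phi A eta + (lambda * delta)%:E.
Proof.
move=> lambda0 eta_delta; rewrite -leeBlDr//.
apply: le_ereal_inf_tmp => _ [x [Ax phix] <-]; rewrite leeBlDr//.
have /ereal_inf_lt[_ [p _ <-] phixp] :
    ereal_inf [set phi (x, p) | p in [set: P]] < delta%:E.
  by apply: le_lt_trans phix _; rewrite lte_fin.
apply: ge_ereal_inf; exists (penalty f phi lambda (x, p)); first by exists (x, p).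
by rewrite leeD2l// EFinM lee_wpmul2l ?lee_fin// ltW.
Qed.

Lemma inf_penalty_le_sup_beta (R : realType) (X P : Type) (A : set X)
  (f : X -> \bar R) (phi : X * P -> \bar R) (lambda : R) :
  (0 <= lambda)%R ->
  ereal_inf [set penalty f phi lambda z | z in A `*` [set: P]] <=
    ereal_sup [set beta f phi A eta | eta in [set eta : R | (0 < eta)%R]].
Proof.
move=> lambda0; apply/lee_addgt0Pr => e e0.
have lambda1 : (0 < lambda + 1)%R by rewrite ltr_wpDl.
(* This makes [lambda * delta <= e]; the [+ 1] keeps the denominator positive when [lambda = 0]. *)
pose delta := (e / (lambda + 1))%R.
have delta0 : (0 < delta)%R by rewrite divr_gt0.
have delta2 : (delta / 2 < delta)%R by rewrite ltr_pdivrMr// ltr_pMr// ltr1n.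
apply: le_trans (inf_penalty_le_beta _ _ _ A f phi _ _ _ lambda0 delta2) _.
apply: leeD.
  by apply: ereal_sup_ubound; exists (delta / 2)%R; rewrite //= divr_gt0.
by rewrite lee_fin mulrCA ler_piMr ?(ltW e0)// ler_pdivrMr// mul1r lerDl.
Qed.

Lemma exists_inf_penalty_ge (R : realType) (X P : Type) (A : set X)
  (f : X -> \bar R) (phi : X * P -> \bar R) (lambda0 eta c : R) :
  (forall z, 0 <= phi z) -> (0 <= lambda0)%R ->
  bounded_below_on (penalty f phi lambda0) (A `*` [set: P]) ->
  (0 < eta)%R -> c%:E <= beta f phi A eta ->
  exists2 lambda : R, (0 <= lambda)%R &
    c%:E <= ereal_inf [set penalty f phi lambda z | z in A `*` [set: P]].
Proof.
move=> phi0 lambda00 [m mF] eta0 c_beta.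
(* Chosen so that [k * eta = |c - m|], which is at least [c - m]. *)
pose k := (`|c - m| / eta)%R.
have k0 : (0 <= k)%R by rewrite divr_ge0// ltW.
exists (lambda0 + k)%R; first exact: addr_ge0.
apply: le_ereal_inf_tmp => _ [[x p] [Ax _] <-].
have [phix|phix] :=
    leP (ereal_inf [set phi (x, p) | p in [set: P]]) eta%:E.
  apply: (le_trans c_beta); apply: (@le_trans _ _ (f x)).
    by apply: ereal_inf_lbound; exists x.
  by rewrite leeDl// mule_ge0// lee_fin addr_ge0.
(* Distributing over [phi (x, p)], possibly [+oo], is legitimate since [lambda0] and [k] are both
   nonnegative. *)
have -> : penalty f phi (lambda0 + k) (x, p)
    = penalty f phi lambda0 (x, p) + k%:E * phi (x, p).
  by rewrite /penalty EFinD ge0_muleDl ?lee_fin// addeA.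
apply: (@le_trans _ _ (m%:E + k%:E * eta%:E)).
  rewrite -EFinM -EFinD lee_fin divfK ?gt_eqF// -lerBlDl.
  exact: ler_norm.
apply: leeD; first exact: mF.
rewrite lee_wpmul2l ?lee_fin//; apply/ltW/(lt_le_trans phix).
by apply: ereal_inf_lbound; exists p.
Qed.

(** Real lower bounds [c] stand in for [beta f phi A eta], which may be [+oo]: each [c] gets its own
    [lambda], and the supremum over [lambda] dominates them all. *)
Lemma beta_le_sup_inf_penalty (R : realType) (X P : Type) (A : set X)
  (f : X -> \bar R) (phi : X * P -> \bar R) (eta : R) :
  (forall z, 0 <= phi z) ->
  (exists lambda : R, (0 <= lambda)%R /\
    bounded_below_on (penalty f phi lambda) (A `*` [set: P])) ->
  (0 < eta)%R ->
  beta f phi A eta <=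
    ereal_sup [set ereal_inf [set penalty f phi lambda z | z in A `*` [set: P]]
              | lambda in [set lambda : R | (0 <= lambda)%R]].
Proof.
move=> phi0 [lambda0 [lambda00 bnd]] eta0; set S := ereal_sup _.
have le_S (c : R) : c%:E <= beta f phi A eta -> c%:E <= S.
  move=> /(exists_inf_penalty_ge _ _ _ _ _ _ _ _ _ phi0 lambda00 bnd eta0).
  move=> [lambda lambda_ge0 /le_trans]; apply.
  by apply: ereal_sup_ubound; exists lambda.
case: (beta f phi A eta) le_S => [r|le_S|_].
- exact.
- suff -> : S = +oo by [].
  by apply/eqyP => c _; rewrite le_S// leey.
- exact: leNye.
Qed.

Theorem theorem3p15 (R : realType) (X P : metricType R)
  (M A : set X) (f : X -> \bar R) (p0 : P) (phi : X * P -> \bar R)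
  (M_neq0 : M !=set0) (A_neq0 : A !=set0)
  (f_gtNy : forall x, -oo < f x)
  (f_min : attains_finite_min f (M `&` A))
  (phi_ge0 : forall z, 0 <= phi z)
  (phi_eq0 : forall x p, phi (x, p) = 0 <-> p = p0 /\ M x)
  (bounded : exists lambda : R,
    (0 <= lambda)%R /\
    bounded_below_on (penalty f phi lambda) (A `*` [set: P])) :
  beta f phi A eta @[eta --> (0:R)^'+] -->
    ereal_sup [set ereal_inf [set penalty f phi lambda z | z in A `*` [set: P]]
              | lambda in [set lambda : R | (0 <= lambda)%R]].
Proof.
(* A nonincreasing function tends at [0^'+] to its supremum over [eta > 0], so it suffices to
   identify that supremum with the one over [lambda]. *)
have -> : ereal_sup
    [set ereal_inf [set penalty f phi lambda z | z in A `*` [set: P]]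
    | lambda in [set lambda : R | (0 <= lambda)%R]] =
    ereal_sup [set beta f phi A eta | eta in [set` `]0%R, +oo[]].
  rewrite set_itvE; apply/eqP; rewrite eq_le; apply/andP; split.
    by apply: ge_ereal_sup => _ [lambda lambda0 <-]; exact: inf_penalty_le_sup_beta.
  apply: ge_ereal_sup => _ [eta eta0 <-].
  exact: beta_le_sup_inf_penalty.
apply: nonincreasing_at_right_cvge => // s t _ _; exact: beta_nonincreasing.
Qed.
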